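(* Let $n,r$ be positive integers and $v\in\mathbb{R}^n$. The set $$\mathcal{B}_v(n,r):=\{X\in\mathbb{R}^{n\times r} : X^\top X=I_r,\ X^\top v=0\}$$ is an embedded submanifold of $\mathbb{R}^{n\times r}$, and $\mathcal{B}_v(n,r)$ is compact.
   Context: $\mathbb{R}^{n\times r}$ is the Euclidean space of real $n\times r$ matrices with the trace inner product; $I_r$ is the $r\times r$ identity matrix. The vector $v$ is allowed to be zero. *)

(* Defs.v *)
From mathcomp Require Import all_boot all_order all_algebra.
From mathcomp Require Import all_classical all_reals all_analysis.

Set Implicit Arguments.
Unset Strict Implicit.
Unset Printing Implicit Defensive.

Import Order.TTheory GRing.Theory Num.Theory.
Import numFieldNormedType.Exports.

Local Open Scope classical_set_scope.
Local Open Scope ring_scope.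

(* C^k regularity of [f] on [U]; only meant for [U] open and [E]
   finite-dimensional, where continuity of all iterated directional
   derivatives is the usual C^k condition. *)
Fixpoint Ck_on (R : realType) (E F : normedModType R) (k : nat)
    (U : set E) (f : E -> F) : Prop :=
  match k with
  | 0 => forall x, U x -> {for x, continuous f}
  | k'.+1 => (forall x, U x -> differentiable f x) /\
             (forall v : E, Ck_on k' U (fun x => 'D_v f x))
  end.

Definition smooth_on (R : realType) (E F : normedModType R)
    (U : set E) (f : E -> F) : Prop :=
  forall k, Ck_on k U f.

(* [f] and [g] are total functions; their values off [U] and [V] are
   irrelevant. *)
Definition diffeo_between (R : realType) (E F : normedModType R)
    (U : set E) (V : set F) (f : E -> F) (g : F -> E) : Prop :=
  [/\ open U, open V,
      (forall x, U x -> V (f x) /\ g (f x) = x),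
      (forall y, V y -> U (g y) /\ f (g y) = y)
    & smooth_on U f /\ smooth_on V g].

(* The subspace R^d x {0} of R^N. *)
Definition coord_slice (R : realType) (N d : nat) : set 'rV[R]_N :=
  [set y | forall j : 'I_N, (d <= j)%N -> y 0 j = 0].
Arguments coord_slice : clear implicits.

(* Embedded submanifolds (smooth, without boundary, of constant dimension [d])
   of the space of n x r matrices, by the local slice condition: around each
   point of [M] a smooth chart of the ambient space, valued in R^(nr), sends
   [M] to R^d x {0}.  The empty set qualifies (with any [d]).  The max norm
   that the library puts on matrices is equivalent to the norm of the trace
   inner product, so it gives the same open sets and smooth maps. *)
Definition embedded_submanifold_dim (R : realType) (n r d : nat)
    (M : set 'M[R]_(n, r)) : Prop :=
  forall x, M x ->
    exists (U : set 'M[R]_(n, r)) (V : set 'rV[R]_(n * r))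
           (f : 'M[R]_(n, r) -> 'rV[R]_(n * r))
           (g : 'rV[R]_(n * r) -> 'M[R]_(n, r)),
      [/\ U x, diffeo_between U V f g
        & f @` (U `&` M) = V `&` coord_slice R (n * r)%N d].

Definition embedded_submanifold (R : realType) (n r : nat)
    (M : set 'M[R]_(n, r)) : Prop :=
  exists2 d, (d <= n * r)%N & embedded_submanifold_dim d M.

Definition Bset (R : realType) (n r : nat) (v : 'cV[R]_n) :
    set 'M[R]_(n, r) :=
  [set X | X^T *m X = 1%:M /\ X^T *m v = 0].
Arguments Bset {R} n r v.

(* Main.v *)
(** Let [X0] be a point of the set, [P = 1 - X0 X0^T], and [Y = X0^T X].  Near
    [X0] the matrix [1 + Y] is invertible; put [C = (1 + Y)^-1], let
    [T = (1 - Y) C] be the Cayley transform of [Y], and [W = P X C].  Then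
    [T + T^T - 2 W^T W = 2 C^T (1 - X^T X) C], so that [X^T X = 1] becomes the
    graph condition [(T + T^T) / 2 = W^T W], while [X^T v = 0] becomes
    [W^T v = 0].  Hence the rational chart [X |-> X0 (T - W^T W) + W], whose
    inverse is rational too, straightens the set to the linear space of the
    [Z] with [X0^T Z + Z^T X0 = 0] and [Z^T v = 0].  The linear system has the
    same rank at every [X0], which gives the constant dimension. *)

Require Import Defs.
From HB Require Import structures.
From mathcomp Require Import all_boot all_order all_algebra all_fingroup zify.
From mathcomp Require Import all_classical all_reals all_analysis.
Import Order.TTheory GRing.Theory Num.Theory.
Import numFieldNormedType.Exports.

Local Open Scope classical_set_scope.
Local Open Scope ring_scope.

(** * Smooth functions *)

(** Differentiability is local: [g] inherits the first-order expansion of [f], and uniqueness of the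
    differential then identifies ['d f x] as that of [g]. *)
Lemma near_eq_differentiable {R : realType} {E F : normedModType R}
    (f g : E -> F) (x : E) :
  {near x, f =1 g} -> differentiable f x -> differentiable g x.
Proof.
move=> fg df.
have [fc /eqaddoP fo] := (diff_locallyP x f).1 df.
have go : g \o shift x = cst (g x) + 'd f x +o_ (0 : E) id.
  have fgx : f x = g x := nbhs_singleton fg.
  apply/eqaddoP => e e0; move: fg; rewrite (near_shift 0) => fg.
  near=> h.
  have fgh : f (h + x) = g (h + x).
    by near: h; apply: filterS fg => h /=; rewrite subr0.
  have : `|(f \o shift x - (cst (f x) + 'd f x)) h| <= e * `|h|.
    by near: h; exact: fo.
  by rewrite !fctE /= fgh fgx.
apply/diff_locallyP; rewrite (diff_unique fc go); split=> //.
Unshelve. all: by end_near. Qed.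

(** * Calculus of C^k scalar functions on an open set *)

Section SmoothScalar.
Context {R : realType} {E : normedModType R}.
Implicit Types (U : set E) (k : nat).

(** As [U] is open, equality on [U] is equality near each of its points, so the directional
    derivatives agree on [U] as well. *)
Lemma eq_Ck_on {F : normedModType R} U k (f g : E -> F) :
  open U -> (forall x, U x -> f x = g x) -> Ck_on k U f -> Ck_on k U g.
Proof.
move=> Uo; have nearU x : U x -> \forall y \near x, U y.
  by move=> Ux; apply: open_nbhs_nbhs.
elim: k f g => [|k IH] f g fg /=.
  move=> fc x Ux; have fgx : {near x, f =1 g}.
    by apply: filterS (nearU x Ux) => y; exact: fg.
  have fcx : f @ x --> g x by rewrite -(fg x Ux); exact: fc.
  apply: cvg_trans fcx.
  by apply: near_eq_cvg; apply: filterS fgx => y ->.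
move=> [fd fD]; have fgx x : U x -> {near x, f =1 g}.
  by move=> Ux; apply: filterS (nearU x Ux) => y; exact: fg.
split=> [x Ux|v]; first exact: near_eq_differentiable (fgx x Ux) (fd x Ux).
apply: IH (fD v) => x Ux; exact: near_eq_derive (fgx x Ux).
Qed.

Lemma Ck_on_pred {F : normedModType R} U k (f : E -> F) :
  Ck_on k.+1 U f -> Ck_on k U f.
Proof.
elim: k f => [|k IH] f [fd fD].
  by move=> x /fd /differentiable_continuous.
by split=> // v; exact: IH (fD v).
Qed.

Lemma Ck_on_cst {F : normedModType R} U k (a : F) : Ck_on k U (fun _ : E => a).
Proof.
elim: k a => [|k IH] a /=; first by move=> x _; exact: cst_continuous.
split=> [x _|v]; first exact: differentiable_cst.
rewrite (_ : (fun x => 'D_v (fun=> a) x) = (fun=> 0 : F)); first exact: IH.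
by apply/funext => x; exact: derive_cst.
Qed.

Lemma Ck_onD U k (f g : E -> R^o) :
  open U -> Ck_on k U f -> Ck_on k U g -> Ck_on k U (fun x => f x + g x : R^o).
Proof.
move=> Uo; elim: k f g => [|k IH] f g /=.
  by move=> fc gc x Ux; apply: (@continuousD _ _ _ f g); [exact: fc|exact: gc].
move=> [fd fD] [gd gD]; split=> [x Ux|v].
  exact: (differentiableD (fd x Ux) (gd x Ux)).
apply: eq_Ck_on (IH _ _ (fD v) (gD v)) => // x Ux.
by rewrite -(deriveD (diff_derivable (fd x Ux)) (diff_derivable (gd x Ux))).
Qed.

(** The Leibniz rule leaves one factor of each term undifferentiated; [Ck_on_pred] lowers its order
    to that of the induction hypothesis. *)
Lemma Ck_onM U k (f g : E -> R^o) :
  open U -> Ck_on k U f -> Ck_on k U g -> Ck_on k U (fun x => f x * g x : R^o).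
Proof.
move=> Uo; elim: k f g => [|k IH] f g.
  by move=> fc gc x Ux; apply: (@continuousM _ _ f g); [exact: fc|exact: gc].
move=> fk gk; move: (fk) (gk) => [fd fD] [gd gD]; split=> [x Ux|v].
  exact: (differentiableM (fd x Ux) (gd x Ux)).
apply: (eq_Ck_on _ _ (fun x => f x * 'D_v g x + g x * 'D_v f x)) => //.
  move=> x Ux.
  exact/esym/(deriveM (diff_derivable (fd x Ux)) (diff_derivable (gd x Ux))).
by apply: Ck_onD => //; apply: IH;
  [exact: Ck_on_pred fk|exact: gD|exact: Ck_on_pred gk|exact: fD].
Qed.

(** Since (1/f)' = -(1/f)(1/f)f', order k for 1/f gives order k+1. *)
Lemma Ck_onV U k (f : E -> R^o) : open U -> (forall x, U x -> f x != 0) ->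
  Ck_on k U f -> Ck_on k U (fun x => (f x)^-1 : R^o).
Proof.
move=> Uo f0; elim: k => [|k IH].
  by move=> fc x Ux; apply: (@continuousV _ _ f); [exact: f0|exact: fc].
move=> fk; move: (fk) => [fd fD]; split=> [x Ux|v].
  exact: (differentiableV (fd x Ux) (f0 x Ux)).
have fV := IH (Ck_on_pred _ _ _ fk).
apply: (eq_Ck_on _ _ (fun x => (-1) * ((f x)^-1 * (f x)^-1) * 'D_v f x)) => //.
  move=> x Ux.
  by rewrite (deriveV (f0 x Ux) (diff_derivable (fd x Ux))) mulN1r -invfM.
apply: Ck_onM (fD v) => //; apply: Ck_onM => //; last exact: Ck_onM.
exact: (Ck_on_cst U k (-1 : R^o)).
Qed.

Lemma Ck_on_sum U k (I : Type) (s : seq I) (P : pred I) (f : I -> E -> R^o) :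
  open U -> (forall i, Ck_on k U (f i)) ->
  Ck_on k U (fun x => \sum_(i <- s | P i) f i x : R^o).
Proof.
move=> Uo fk; elim: s => [|i s IH].
  rewrite (_ : (fun x => _) = fun=> 0); first exact: Ck_on_cst.
  by apply/funext => x; rewrite big_nil.
rewrite (_ : (fun x => _) = fun x => (if P i then f i x else 0) +
    \sum_(j <- s | P j) f j x); last first.
  by apply/funext => x; rewrite big_cons; case: (P i); rewrite ?add0r.
apply: Ck_onD => //; case: (P i) => //; exact: Ck_on_cst.
Qed.

Lemma Ck_on_prod U k (I : Type) (s : seq I) (P : pred I) (f : I -> E -> R^o) :
  open U -> (forall i, Ck_on k U (f i)) ->
  Ck_on k U (fun x => \prod_(i <- s | P i) f i x : R^o).
Proof.
move=> Uo fk; elim: s => [|i s IH].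
  rewrite (_ : (fun x => _) = fun=> 1); first exact: Ck_on_cst.
  by apply/funext => x; rewrite big_nil.
rewrite (_ : (fun x => _) = fun x => (if P i then f i x else 1) *
    \prod_(j <- s | P j) f j x); last first.
  by apply/funext => x; rewrite big_cons; case: (P i); rewrite ?mul1r.
apply: Ck_onM => //; case: (P i) => //; exact: Ck_on_cst.
Qed.

End SmoothScalar.

(** * Smooth matrix-valued maps, entry by entry *)

Section SmoothMatrix.
Context {R : realType} {E : normedModType R}.
Implicit Types (U : set E).

(* Entrywise, so that products and inverses reduce to scalar functions. *)
Definition smooth_mx {m p} U (F : E -> 'M[R]_(m, p)) : Prop :=
  forall i j k, Ck_on k U (fun x => F x i j : R^o).

(** [F] is the sum of its entries times elementary matrices, hence differentiable; its directional
    derivatives are taken entrywise, so they are again entrywise smooth and the induction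
    proceeds. *)
Lemma smooth_mx_on {m p} U (F : E -> 'M[R]_(m, p)) :
  open U -> smooth_mx U F -> smooth_on U F.
Proof.
move=> Uo sF k; elim: k F sF => [|k IH] F sF.
  (* A neighbourhood of a matrix contains a product of neighbourhoods [Q i j] of its entries. *)
  move=> x Ux S /= [Q nQ QS].
  have : \forall y \near x, forall ij, Q ij.1 ij.2 (F y ij.1 ij.2).
    by apply: filter_forall => -[i j]; exact: (sF i j 0%N x Ux _ (nQ i j)).
  by apply: filterS => y Qy; apply: QS => i j; exact: (Qy (i, j)).
have dF x : U x -> differentiable F x.
  move=> Ux.
  have -> : F = \sum_(ij : 'I_m * 'I_p)
      (fun y => F y ij.1 ij.2 *: delta_mx ij.1 ij.2).
    apply/funext => y; rewrite fct_sumE [LHS]matrix_sum_delta.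
    by rewrite pair_big.
  elim/big_ind: _ => [||[i j] _]; first exact: differentiable_cst.
    by move=> f g; exact: differentiableD.
  by apply: differentiableZl; exact: (sF i j 1%N).1.
split=> // v.
pose DF x := \matrix_(i, j) 'D_v (fun y => F y i j : R^o) x.
apply: (eq_Ck_on _ _ DF) => //.
  by move=> x Ux; rewrite derive_mx //; exact/diff_derivable/dF.
apply: IH => i j l; have [_ /(_ v)] := sF i j l.+1.
by apply: eq_Ck_on => // x Ux; rewrite mxE.
Qed.

Lemma smooth_mx_cst {m p} U (A : 'M[R]_(m, p)) : smooth_mx U (fun=> A).
Proof. by move=> i j k; exact: (Ck_on_cst U k (A i j : R^o)). Qed.

Lemma smooth_mxD {m p} U (F G : E -> 'M[R]_(m, p)) : open U ->
  smooth_mx U F -> smooth_mx U G -> smooth_mx U (fun x => F x + G x).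
Proof.
move=> Uo sF sG i j k.
apply: eq_Ck_on (Ck_onD _ _ _ _ _ (sF i j k) (sG i j k)) => //.
by move=> x _; rewrite mxE.
Qed.

Lemma smooth_mx_mul {m p q} U (F : E -> 'M[R]_(m, p)) (G : E -> 'M[R]_(p, q)) :
  open U -> smooth_mx U F -> smooth_mx U G -> smooth_mx U (fun x => F x *m G x).
Proof.
move=> Uo sF sG i j k.
apply: (eq_Ck_on _ _ (fun x => \sum_l F x i l * G x l j)) => //.
  by move=> x _; rewrite mxE.
by apply: Ck_on_sum => // l; exact: Ck_onM.
Qed.

Lemma smooth_mx_scale {m p} U (a : R) (F : E -> 'M[R]_(m, p)) :
  open U -> smooth_mx U F -> smooth_mx U (fun x => a *: F x).
Proof.
move=> Uo sF; under eq_fun do rewrite -mul_scalar_mx.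
exact: smooth_mx_mul (smooth_mx_cst _ _) _.
Qed.

Lemma smooth_mxB {m p} U (F G : E -> 'M[R]_(m, p)) : open U ->
  smooth_mx U F -> smooth_mx U G -> smooth_mx U (fun x => F x - G x).
Proof.
move=> Uo sF sG; under eq_fun do rewrite -scaleN1r.
by apply: smooth_mxD => //; exact: smooth_mx_scale.
Qed.

Lemma smooth_mx_tr {m p} U (F : E -> 'M[R]_(m, p)) :
  smooth_mx U F -> smooth_mx U (fun x => (F x)^T).
Proof. by move=> sF i j k; under eq_fun do rewrite mxE; exact: sF. Qed.

Lemma smooth_mxvec {m p} U (F : E -> 'M[R]_(m, p)) :
  smooth_mx U F -> smooth_mx U (fun x => mxvec (F x)).
Proof.
move=> sF i j k; case/mxvec_indexP: j => a b.
by rewrite ord1; under eq_fun do rewrite mxvecE; exact: sF.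
Qed.

Lemma smooth_vec_mx {m p} U (F : E -> 'rV[R]_(m * p)) :
  smooth_mx U F -> smooth_mx U (fun x => vec_mx (F x)).
Proof. by move=> sF i j k; under eq_fun do rewrite mxE; exact: sF. Qed.

Lemma Ck_on_det {m} U k (F : E -> 'M[R]_m) : open U ->
  (forall i j, Ck_on k U (fun x => F x i j : R^o)) ->
  Ck_on k U (fun x => \det (F x) : R^o).
Proof.
move=> Uo sF; apply: Ck_on_sum => // s; apply: Ck_onM => //.
  exact: (Ck_on_cst U k (_ : R^o)).
by apply: Ck_on_prod.
Qed.

(** Cramer's rule: each entry of the inverse is a cofactor over the determinant. *)
Lemma smooth_invmx {m} U (F : E -> 'M[R]_m) : open U ->
  (forall x, U x -> F x \in unitmx) ->
  smooth_mx U F -> smooth_mx U (fun x => invmx (F x)).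
Proof.
move=> Uo uF sF i j k.
apply: (eq_Ck_on _ _ (fun x => (\det (F x))^-1 * cofactor (F x) j i)) => //.
  by move=> x Ux; rewrite /invmx uF // !mxE.
apply: Ck_onM => //.
  apply: Ck_onV => //; last by apply: Ck_on_det => // a b; exact: sF.
  by move=> x /uF; rewrite unitmxE unitfE.
apply: Ck_onM => //; first exact: (Ck_on_cst U k (_ : R^o)).
by apply: Ck_on_det => // a b; under eq_fun do rewrite !mxE; exact: sF.
Qed.

Lemma open_unitmx_preimage {m} (F : E -> 'M[R]_m) :
  smooth_mx setT F -> open [set x | F x \in unitmx].
Proof.
move=> sF; have cdet : continuous (fun x => \det (F x) : R^o).
  move=> x.
  by apply: (Ck_on_det setT 0%N) => [|i j|]; [exact: openT|exact: sF|].
rewrite (_ : [set _ | _] = (fun x => \det (F x) : R^o) @^-1` [set y | y != 0]).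
  by apply: open_comp => [x _|]; [exact: cdet|exact: open_neq].
by apply/seteqP; split=> x /=; rewrite unitmxE unitfE.
Qed.

End SmoothMatrix.

Lemma smooth_mx_id {R : realType} {m p} (U : set 'M[R]_(m, p)) :
  smooth_mx U (fun x => x).
Proof.
move=> i j [|k]; first by move=> x _; exact: coord_continuous.
split=> [x _|v]; first exact: differentiable_coord.
rewrite (_ : (fun x => _) = (fun=> v i j : R^o)); first exact: Ck_on_cst.
(* For [h != 0] the difference quotient of the coordinate is exactly [v i j]. *)
apply/funext => x; apply: cvg_lim => //; apply: cvg_near_cst.
near=> h; rewrite /= !mxE addrK [_ *: _]mulKf //.
by near: h; exact: nbhs_dnbhs_neq.
Unshelve. all: by end_near. Qed.

(** * The Cayley chart of the Stiefel manifold *)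

Section Chart.
Context {R : realType} {n r : nat} (X0 : 'M[R]_(n, r)).
Context (X0X0 : X0^T *m X0 = 1%:M).

Let P : 'M[R]_n := 1%:M - X0 *m X0^T.

Lemma tr_normal_proj : P^T = P.
Proof. by rewrite /P linearB /= trmx1 trmx_mul trmxK. Qed.

Lemma trX0_normal_proj : X0^T *m P = 0.
Proof. by rewrite mulmxBr mulmx1 mulmxA X0X0 mul1mx subrr. Qed.

Lemma normal_proj_X0 : P *m X0 = 0.
Proof. by rewrite mulmxBl mul1mx -mulmxA X0X0 mulmx1 subrr. Qed.

Lemma normal_proj_idem : P *m P = P.
Proof.
by rewrite {1}/P mulmxBl mul1mx -mulmxA trX0_normal_proj mulmx0 subr0.
Qed.

(** [invmx] returns a singular matrix unchanged, so this is the Cayley transform only where [1 + Y]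
    is invertible. *)
Definition cayley (Y : 'M[R]_r) : 'M[R]_r := (1%:M - Y) *m invmx (1%:M + Y).

(** Writing 1 as (1 + Y)(1 + Y)^-1 makes [1 + cayley Y] and [1 - cayley Y] explicit; their quotient
    is [Y], whence [cayley] is an involution. *)
Lemma add1_cayley Y : 1%:M + Y \in unitmx ->
  1%:M + cayley Y = 2 *: invmx (1%:M + Y).
Proof.
move=> uY; rewrite -{1}(mulmxV uY) -mulmxDl addrACA subrr addr0.
by rewrite -mulr2n -scaler_nat -scalemxAl mul1mx.
Qed.

Lemma sub1_cayley Y : 1%:M + Y \in unitmx ->
  1%:M - cayley Y = 2 *: (Y *m invmx (1%:M + Y)).
Proof.
move=> uY; rewrite -{1}(mulmxV uY) -mulmxBl opprB addrC addrA subrK.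
by rewrite -mulr2n -scaler_nat -scalemxAl.
Qed.

Lemma unit_add1_cayley Y :
  1%:M + Y \in unitmx -> 1%:M + cayley Y \in unitmx.
Proof.
move=> uY; rewrite add1_cayley // unitmxZ ?unitmx_inv //.
by rewrite unitfE pnatr_eq0.
Qed.

Lemma invmx_add1_cayley Y : 1%:M + Y \in unitmx ->
  invmx (1%:M + cayley Y) = 2^-1 *: (1%:M + Y).
Proof.
move=> uY; rewrite add1_cayley // invmxZ ?invmxK //.
by rewrite unitmxZ ?unitmx_inv // unitfE pnatr_eq0.
Qed.

Lemma cayleyK Y : 1%:M + Y \in unitmx -> cayley (cayley Y) = Y.
Proof.
move=> uY; rewrite {1}/cayley sub1_cayley // invmx_add1_cayley //.
by rewrite -scalemxAl -scalemxAr scalerA divff ?pnatr_eq0 // scale1r mulmxKV.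
Qed.

Definition stiefel_chart (X : 'M[R]_(n, r)) : 'M[R]_(n, r) :=
  let W := P *m X *m invmx (1%:M + X0^T *m X) in
  X0 *m (cayley (X0^T *m X) - W^T *m W) + W.

(* The matrix [T], read off from [Z = X0 (T - W^T W) + W], where [W = P Z]. *)
Definition stiefel_param_core (Z : 'M[R]_(n, r)) : 'M[R]_r :=
  X0^T *m Z + (P *m Z)^T *m (P *m Z).

(** Solves for [X]: as [cayley] is an involution, X0^T X = cayley T, and 1 + T = 2 C turns P X = W
    C^-1 into 2 W (1 + T)^-1. *)
Definition stiefel_param (Z : 'M[R]_(n, r)) : 'M[R]_(n, r) :=
  let T := stiefel_param_core Z in
  X0 *m cayley T + 2 *: (P *m Z *m invmx (1%:M + T)).

Lemma normal_proj_chart X :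
  P *m stiefel_chart X = P *m X *m invmx (1%:M + X0^T *m X).
Proof.
rewrite /stiefel_chart mulmxDr 2!mulmxA normal_proj_X0 mul0mx add0r.
by rewrite !mulmxA normal_proj_idem.
Qed.

Lemma trX0_chart X : let W := P *m X *m invmx (1%:M + X0^T *m X) in
  X0^T *m stiefel_chart X = cayley (X0^T *m X) - W^T *m W.
Proof.
move=> W; rewrite /stiefel_chart -/W mulmxDr mulmxA X0X0 mul1mx.
by rewrite {3}/W !mulmxA trX0_normal_proj !mul0mx addr0.
Qed.

Lemma param_core_chart X :
  stiefel_param_core (stiefel_chart X) = cayley (X0^T *m X).
Proof. by rewrite /stiefel_param_core trX0_chart normal_proj_chart subrK. Qed.

Lemma stiefel_chartK X : 1%:M + X0^T *m X \in unitmx ->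
  stiefel_param (stiefel_chart X) = X.
Proof.
move=> uX; rewrite /stiefel_param param_core_chart cayleyK // normal_proj_chart.
rewrite invmx_add1_cayley // -scalemxAr scalerA divff ?pnatr_eq0 // scale1r.
by rewrite mulmxKV // mulmxA mulmxBl mul1mx addrC subrK.
Qed.

Lemma trX0_param Z : X0^T *m stiefel_param Z = cayley (stiefel_param_core Z).
Proof.
rewrite /stiefel_param mulmxDr mulmxA X0X0 mul1mx -scalemxAr.
by rewrite !mulmxA trX0_normal_proj !mul0mx scaler0 addr0.
Qed.

Lemma normal_proj_param Z : P *m stiefel_param Z =
  2 *: (P *m Z *m invmx (1%:M + stiefel_param_core Z)).
Proof.
rewrite /stiefel_param mulmxDr mulmxA normal_proj_X0 mul0mx add0r.
by rewrite -scalemxAr !mulmxA normal_proj_idem.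
Qed.

Lemma stiefel_paramK Z : 1%:M + stiefel_param_core Z \in unitmx ->
  stiefel_chart (stiefel_param Z) = Z.
Proof.
move=> uZ; rewrite /stiefel_chart trX0_param normal_proj_param cayleyK //.
rewrite invmx_add1_cayley //; set T := 1%:M + stiefel_param_core Z in uZ *.
(* Hence the [W] of the chart is [P Z], and subtracting W^T W from the core leaves X0^T Z. *)
have -> (A : 'M[R]_(n, r)) : (2 *: (A *m invmx T)) *m (2^-1 *: T) = A.
  by rewrite -scalemxAl -scalemxAr scalerA divff ?pnatr_eq0 // scale1r mulmxKV.
by rewrite addrK mulmxA mulmxBl mul1mx addrC subrK.
Qed.

Lemma cayley_sym Y : 1%:M + Y \in unitmx ->
  let C := invmx (1%:M + Y) in
  cayley Y + (cayley Y)^T = 2 *: (C^T *m (1%:M - Y^T *m Y) *m C).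
Proof.
move=> uY C.
(* Insert [1 = ((1 + Y) C)^T] on the left of [(1 - Y) C]. *)
have T1 : cayley Y = C^T *m ((1%:M + Y)^T *m (1%:M - Y)) *m C.
  by rewrite mulmxA -trmx_mul mulmxV // trmx1 mul1mx.
have T2 : (cayley Y)^T = C^T *m ((1%:M - Y)^T *m (1%:M + Y)) *m C.
  by rewrite T1 !trmx_mul !trmxK !mulmxA.
rewrite T2 T1 -mulmxDl -mulmxDr scalemxAl scalemxAr; congr (_ *m _ *m _).
(* The two products share the symmetric part 1 - Y^T Y; their skew parts are opposite and cancel in
   the sum. *)
have -> : (1%:M + Y)^T *m (1%:M - Y) = (1%:M - Y^T *m Y) + (Y^T - Y).
  rewrite [_^T]linearD /= trmx1 mulmxBr mulmx1 mulmxDl mul1mx.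
  by rewrite opprD [- Y + _]addrC addrACA.
have -> : (1%:M - Y)^T *m (1%:M + Y) = (1%:M - Y^T *m Y) - (Y^T - Y).
  rewrite [_^T]linearB /= trmx1 mulmxDr mulmx1 mulmxBl mul1mx.
  by rewrite opprB [Y - _]addrC addrACA [- _ + Y]addrC.
by rewrite addrACA subrr addr0 scaler_nat mulr2n.
Qed.

(** Pythagoras: [P] is symmetric and idempotent, and 1 = X0 X0^T + P. *)
Lemma gram_split (X : 'M[R]_(n, r)) :
  X^T *m X = (X0^T *m X)^T *m (X0^T *m X) + (P *m X)^T *m (P *m X).
Proof.
rewrite [(P *m X)^T]trmx_mul tr_normal_proj [X^T *m P *m _]mulmxA.
rewrite -[X^T *m P *m P]mulmxA normal_proj_idem.
by rewrite mulmxBr mulmx1 mulmxBl trmx_mul trmxK !mulmxA addrC subrK.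
Qed.

(** W^T W is symmetric, so it is subtracted twice; [gram_split] merges it with the 1 - Y^T Y of
    [cayley_sym] into 1 - X^T X. *)
Lemma chart_orthonormality (X : 'M[R]_(n, r)) : 1%:M + X0^T *m X \in unitmx ->
  let C := invmx (1%:M + X0^T *m X) in
  X0^T *m stiefel_chart X + (stiefel_chart X)^T *m X0 =
  2 *: (C^T *m (1%:M - X^T *m X) *m C).
Proof.
move=> uX C; rewrite -[X in _ + X]trmxK trmx_mul trmxK trX0_chart -/C.
set W := P *m X *m C.
rewrite linearB /= addrACA cayley_sym // -/C [(W^T *m W)^T]trmx_mul trmxK.
rewrite -opprD -mulr2n -[_ *m W *+ 2]scaler_nat -scalerBr; congr (_ *: _).
have -> : W^T *m W = C^T *m ((P *m X)^T *m (P *m X)) *m C.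
  by rewrite /W trmx_mul !mulmxA.
by rewrite -mulmxBl -mulmxBr (gram_split X) opprD addrA.
Qed.

(** Here P v = v, so only the normal component P X C of the chart pairs with [v]. *)
Lemma chart_orthogonality (v : 'cV[R]_n) X : X0^T *m v = 0 ->
  (stiefel_chart X)^T *m v = (invmx (1%:M + X0^T *m X))^T *m (X^T *m v).
Proof.
move=> X0v; have Pv : P *m v = v.
  by rewrite mulmxBl mul1mx -mulmxA X0v mulmx0 subr0.
rewrite -{1}Pv mulmxA -{1}tr_normal_proj -trmx_mul normal_proj_chart !trmx_mul.
by rewrite tr_normal_proj -!mulmxA Pv.
Qed.

(** Both linear conditions form a single map. Its first block is symmetric and repeats equations, so
    the codimension is taken to be the rank of the map. *)
Definition tangent_constraint (v : 'cV[R]_n) (Z : 'M[R]_(n, r)) :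
    'M[R]_(r, r + 1) :=
  row_mx (X0^T *m Z + Z^T *m X0) (Z^T *m v).

(** Up to the factor 2, the blocks are 1 - X^T X and X^T v multiplied by the invertible C^T and
    C. *)
Lemma Bset_chart (v : 'cV[R]_n) X : X0^T *m v = 0 ->
  1%:M + X0^T *m X \in unitmx ->
  Bset n r v X <-> tangent_constraint v (stiefel_chart X) = 0.
Proof.
move=> X0v uX; rewrite /tangent_constraint.
rewrite chart_orthonormality // chart_orthogonality //.
set C := invmx _; have uC : C \in unitmx by rewrite unitmx_inv.
have uCT : C^T \in unitmx by rewrite unitmx_tr.
rewrite -[0]row_mx0; split=> [[-> ->]|/eq_row_mx[/eqP + Xv]].
  by rewrite subrr !mulmx0 mul0mx scaler0.
rewrite scaler_eq0 pnatr_eq0 /= => /eqP XX; split; last first.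
  by rewrite -(mulKmx uCT (X^T *m v)) Xv mulmx0.
apply/eqP; rewrite eq_sym -subr_eq0; apply/eqP.
by rewrite -(mulKmx uCT (1%:M - _)) -(mulmxK uC (C^T *m _)) XX mul0mx mulmx0.
Qed.

End Chart.

(** * Smoothness of the chart and of its inverse *)

Section SmoothChart.
Context {R : realType} {E : normedModType R} (U : set E) (Uo : open U).

Lemma smooth_cayley {r} (Y : E -> 'M[R]_r) :
  (forall x, U x -> 1%:M + Y x \in unitmx) ->
  smooth_mx U Y -> smooth_mx U (fun x => cayley (Y x)).
Proof.
move=> uY sY; apply: smooth_mx_mul => //.
  by apply: smooth_mxB => //; exact: smooth_mx_cst.
by apply: smooth_invmx => //; apply: smooth_mxD => //; exact: smooth_mx_cst.
Qed.

Context {n r : nat} (X0 : 'M[R]_(n, r)) (F : E -> 'M[R]_(n, r)).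
Context (sF : smooth_mx U F).

Lemma smooth_stiefel_param_core :
  smooth_mx U (fun x => stiefel_param_core X0 (F x)).
Proof.
have sM m (A : 'M[R]_(m, n)) : smooth_mx U (fun x => A *m F x).
  by apply: smooth_mx_mul => //; exact: smooth_mx_cst.
by apply: smooth_mxD => //; apply: smooth_mx_mul => //; exact: smooth_mx_tr.
Qed.

Lemma smooth_stiefel_param :
  (forall x, U x -> 1%:M + stiefel_param_core X0 (F x) \in unitmx) ->
  smooth_mx U (fun x => stiefel_param X0 (F x)).
Proof.
move=> uF; have sT := smooth_stiefel_param_core.
apply: smooth_mxD => //.
  apply: smooth_mx_mul => //; first exact: smooth_mx_cst.
  exact: smooth_cayley.
apply: smooth_mx_scale => //; apply: smooth_mx_mul => //.
  by apply: smooth_mx_mul => //; exact: smooth_mx_cst.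
by apply: smooth_invmx => //; apply: smooth_mxD => //; exact: smooth_mx_cst.
Qed.

Lemma smooth_stiefel_chart :
  (forall x, U x -> 1%:M + X0^T *m F x \in unitmx) ->
  smooth_mx U (fun x => stiefel_chart X0 (F x)).
Proof.
move=> uF.
have sM m (A : 'M[R]_(m, n)) : smooth_mx U (fun x => A *m F x).
  by apply: smooth_mx_mul => //; exact: smooth_mx_cst.
have sW : smooth_mx U (fun x =>
    (1%:M - X0 *m X0^T) *m F x *m invmx (1%:M + X0^T *m F x)).
  apply: smooth_mx_mul => //; apply: smooth_invmx => //.
  by apply: smooth_mxD => //; exact: smooth_mx_cst.
apply: smooth_mxD => //; apply: smooth_mx_mul => //; first exact: smooth_mx_cst.
apply: smooth_mxB => //; first exact: smooth_cayley.
by apply: smooth_mx_mul => //; exact: smooth_mx_tr.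
Qed.

End SmoothChart.

(** * The tangent constraint *)

Lemma kernel_straighten {F : fieldType} {m p} (A : 'M[F]_(m, p)) :
  exists2 B : 'M[F]_m, B \in unitmx & forall u : 'rV[F]_m,
    u *m A = 0 <-> (forall j : 'I_m, (m - \rank A <= j)%N -> (u *m B) 0 j = 0).
Proof.
(* [pid_mx] keeps the leading coordinates, but the kernel condition is to bear
   on the trailing ones: hence the reversal. *)
exists (col_perm (perm (@rev_ord_inj m)) (col_ebase A)) => [|u].
  by rewrite col_permE unitmx_mul col_ebase_unit unitmx_perm.
(* In the factorisation of [A] by [mulmx_ebase], the right factor [row_ebase A] is invertible and
   does not change the kernel. *)
have -> : u *m A = 0 <->
    u *m col_ebase A *m (pid_mx (\rank A) : 'M[F]_(m, p)) = 0.
  rewrite -{1}(mulmx_ebase A) !mulmxA; split=> [|->]; last by rewrite mul0mx.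
  by move/(canRL (mulmxK (row_ebase_unit A))); rewrite mul0mx.
set w := u *m col_ebase A.
have wE (j : 'I_m) : (u *m col_perm (perm (@rev_ord_inj m)) (col_ebase A)) 0 j =
    w 0 (rev_ord j).
  by rewrite !mxE; apply: eq_bigr => i _; rewrite mxE permE.
clearbody w; have rp := rank_leq_col A.
split=> [wA j rj|wA]; first rewrite wE.
  (* [rev_ord j] is m - 1 - j, so the last [\rank A] indices become the first ones. *)
  have jr : (rev_ord j < \rank A)%N.
    by move: (rank_leq_row A) (ltn_ord j) rj => /=; lia.
  have := congr1 (fun M : 'rV[F]_p => M 0 (Ordinal (leq_trans jr rp))) wA.
  rewrite !mxE (bigD1 (rev_ord j)) //= big1 => [|i ij].
    by rewrite mxE eqxx jr mulr1 addr0.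
  by rewrite mxE; move: ij; rewrite -val_eqE => /negPf ->; rewrite mulr0.
apply/rowP => j; rewrite !mxE big1 // => i _; rewrite mxE.
case: (ltnP i (\rank A)) => ir; last by rewrite andbF mulr0.
rewrite -[i]rev_ordK -wE wA ?mul0r //=.
by move: (ltn_ord i) ir; lia.
Qed.

Lemma tangent_constraint_is_linear {R : realType} {n r} (X0 : 'M[R]_(n, r))
  (v : 'cV[R]_n) : linear (tangent_constraint X0 v).
Proof.
move=> a Z1 Z2; rewrite /tangent_constraint scale_row_mx add_row_mx.
rewrite !linearP /= !mulmxDl -!scalemxAl; congr row_mx.
by rewrite scalerDr addrACA.
Qed.

HB.instance Definition _ (R : realType) n r (X0 : 'M[R]_(n, r))
    (v : 'cV[R]_n) :=
  GRing.isLinear.Build R 'M[R]_(n, r) 'M[R]_(r, r + 1) _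
    (tangent_constraint X0 v) (tangent_constraint_is_linear X0 v).

(** The target is (S, Z^T v) with [S] symmetric. The term X0 S / 2 yields [S] in the first block and
    0 in the second; the multiple of v v^T Z yields 0 and Z^T v. *)
Lemma tangent_constraint_transfer {R : realType} {n r} (X0 X1 : 'M[R]_(n, r))
    (v : 'cV[R]_n) (Z : 'M[R]_(n, r)) : X0^T *m X0 = 1%:M -> X0^T *m v = 0 ->
  exists Z', tangent_constraint X0 v Z' = tangent_constraint X1 v Z.
Proof.
move=> X00 X0v; set S := X1^T *m Z + Z^T *m X1.
have ST : S^T = S by rewrite /S linearD /= !trmx_mul !trmxK addrC.
have vX0 : v^T *m X0 = 0 by rewrite -[LHS]trmxK trmx_mul trmxK X0v trmx0.
(* If [v = 0] then [c = 0^-1 = 0], harmless since [Z^T v = 0]. *)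
set c := ((v^T *m v) 0 0)^-1.
exists (2^-1 *: (X0 *m S) + c *: (v *m (v^T *m Z))).
rewrite /tangent_constraint -/S.
have -> : (2^-1 *: (X0 *m S) + c *: (v *m (v^T *m Z)))^T =
    2^-1 *: (S *m X0^T) + c *: (Z^T *m v *m v^T).
  by rewrite linearD /= !linearZ /= !trmx_mul trmxK ST.
congr row_mx.
  rewrite mulmxDr mulmxDl -!scalemxAr -!scalemxAl.
  rewrite [X0^T *m _]mulmxA X00 mul1mx [X0^T *m _]mulmxA X0v mul0mx.
  rewrite -[S *m _ *m _]mulmxA X00 mulmx1 -[_ *m v^T *m _]mulmxA vX0 mulmx0.
  by rewrite scaler0 !addr0 -scalerDl -div1r -splitr scale1r.
rewrite mulmxDl -!scalemxAl -!mulmxA X0v mulmx0 scaler0 add0r.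
have [->|v0] := eqVneq v 0; first by rewrite !mulmx0 scaler0.
rewrite [v^T *m v]mx11_scalar mul_mx_scalar -scalemxAr scalerA.
rewrite mulVf ?scale1r //.
apply: contra v0; rewrite mxE => vv.
have sq0 (i : 'I_n) : true -> 0 <= v^T 0 i * v i 0.
  by rewrite mxE -expr2 sqr_ge0.
apply/eqP/colP => i; move: vv; rewrite psumr_eq0 // => /allP /(_ i).
by rewrite mem_index_enum mxE mulf_eq0 orbb => /(_ isT) /eqP ->; rewrite mxE.
Qed.

(** Transfer in both directions shows that the two maps have the same image. *)
Lemma rank_tangent_constraint {R : realType} {n r} (X0 X1 : 'M[R]_(n, r))
    (v : 'cV[R]_n) : Bset n r v X0 -> Bset n r v X1 ->
  \rank (lin_mx (tangent_constraint X0 v)) =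
  \rank (lin_mx (tangent_constraint X1 v)).
Proof.
have le (Y0 Y1 : 'M[R]_(n, r)) : Bset n r v Y0 ->
    (lin_mx (tangent_constraint Y1 v) <= lin_mx (tangent_constraint Y0 v))%MS.
  move=> [Y00 Y0v]; apply/rV_subP => u /submxP[w ->].
  rewrite -[w]vec_mxK mul_vec_lin /=.
  have [Z' <-] := tangent_constraint_transfer Y0 Y1 v (vec_mx w) Y00 Y0v.
  by rewrite -mul_vec_lin submxMl.
by move=> B0 B1; apply/eqP; rewrite eqn_leq !mxrankS ?le.
Qed.

(** * Compactness and the slice charts *)

(** Heine-Borel is applied to row vectors, and [vec_mx] carries compactness back to matrices. *)
Lemma compact_Bset {R : realType} {n r} (v : 'cV[R]_n) : compact (Bset n r v).
Proof.
have cont (E : normedModType R) m p (F : E -> 'M[R]_(m, p)) :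
    smooth_mx setT F -> continuous F.
  by move=> sF x; exact: (smooth_mx_on setT F openT sF 0%N x).
have -> : Bset n r v = vec_mx @` [set u | Bset n r v (vec_mx u)].
  apply/seteqP; split=> [X BX|X [u Bu <-]] //.
  by exists (mxvec X); rewrite /= ?mxvecK.
apply: continuous_compact.
  apply: continuous_subspaceT; apply: cont; apply: smooth_vec_mx.
  exact: smooth_mx_id.
have sv : smooth_mx setT (fun u : 'rV[R]_(n * r) => (vec_mx u)^T).
  by apply/smooth_mx_tr/smooth_vec_mx/smooth_mx_id.
apply: bounded_closed_compact.
  (* The norm is the largest absolute value of an entry, and the squares in each column of [X] sum
     to 1. *)
  exists 1; split=> // M M1 u [uu _]; apply: le_trans (ltW M1).
  rewrite [leLHS]mx_normrE; apply/bigmax_leP; split=> // -[i j] _ /=.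
  rewrite ord1; case/mxvec_indexP: j => a b; rewrite -[u]vec_mxK mxvecE.
  set X := vec_mx u in uu *; clearbody X.
  have : \sum_k X k b ^+ 2 = 1.
    have := congr1 (fun A : 'M[R]_r => A b b) uu; rewrite !mxE eqxx /=.
    apply: etrans.
    by apply: eq_bigr => k _; rewrite !mxE expr2.
  rewrite (bigD1 a) //= => X1.
  rewrite -(@ler_pXn2r _ 2) ?nnegrE ?normr_ge0 //.
  rewrite expr1n real_normK ?num_real //.
  by rewrite -X1 lerDl sumr_ge0 // => k _; exact: sqr_ge0.
have -> : [set u | Bset n r v (vec_mx u)] =
  (fun u : 'rV[R]_(n * r) => (vec_mx u)^T *m vec_mx u) @^-1` [set 1%:M] `&`
  (fun u => (vec_mx u)^T *m v) @^-1` [set 0] by [].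
have closed_fiber m p (F : 'rV[R]_(n * r) -> 'M[R]_(m, p)) A :
    smooth_mx setT F -> closed (F @^-1` [set A]).
  move=> /cont cF; apply: closed_comp => [u _|]; first exact: cF.
  exact/accessible_closed_set1/hausdorff_accessible/norm_hausdorff.
apply: closedI; apply: closed_fiber; apply: smooth_mx_mul => //.
- exact: openT.
- exact/smooth_vec_mx/smooth_mx_id.
- exact: openT.
- exact: smooth_mx_cst.
Qed.

Theorem lemma2 (R : realType) (n r : nat) (n_gt0 : (0 < n)%N)
    (r_gt0 : (0 < r)%N) (v : 'cV[R]_n) :
  embedded_submanifold (Bset n r v) /\ compact (Bset n r v).
Proof.
split; last exact: compact_Bset.
(* The set may be empty, for instance when r > n; then dimension 0 serves. *)
have [[X1 BX1]|B0] := pselect (Bset n r v !=set0); last first.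
  by exists 0%N => // x Bx; case: B0; exists x.
exists (n * r - \rank (lin_mx (tangent_constraint X1 v)))%N.
  exact: leq_subr.
move=> X0 BX0; rewrite (rank_tangent_constraint X1 X0) //.
have [X00 X0v] := BX0.
have [B uB kerB] := kernel_straighten (lin_mx (tangent_constraint X0 v)).
(* [zof] undoes vectorisation followed by [B], the change of coordinates that makes the kernel a
   coordinate slice. *)
pose zof (y : 'rV[R]_(n * r)) : 'M[R]_(n, r) := vec_mx (y *m invmx B).
pose U := [set X : 'M[R]_(n, r) | 1%:M + X0^T *m X \in unitmx].
pose V := [set y | 1%:M + stiefel_param_core X0 (zof y) \in unitmx].
pose f X := mxvec (stiefel_chart X0 X) *m B.
pose g y := stiefel_param X0 (zof y).
have zofK X : zof (mxvec X *m B) = X by rewrite /zof mulmxK // mxvecK.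
have zofKV y : mxvec (zof y) *m B = y by rewrite /zof vec_mxK mulmxKV.
have fU X : U X -> V (f X) /\ g (f X) = X.
  move=> UX; rewrite /V /g /= /f zofK stiefel_chartK // param_core_chart //.
  by split=> //; exact: unit_add1_cayley.
have gV y : V y -> U (g y) /\ f (g y) = y.
  move=> Vy; rewrite /U /f /= /g stiefel_paramK // zofKV trX0_param //.
  by split=> //; exact: unit_add1_cayley.
have szof W : open W -> smooth_mx W zof.
  move=> Wo; apply: smooth_vec_mx; apply: smooth_mx_mul => //.
    exact: smooth_mx_id.
  exact: smooth_mx_cst.
have Uo : open U.
  apply: open_unitmx_preimage; apply: smooth_mxD; first exact: openT.
    exact: smooth_mx_cst.
  apply: smooth_mx_mul; first exact: openT.
    exact: smooth_mx_cst.
  exact: smooth_mx_id.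
have Vo : open V.
  apply: open_unitmx_preimage; apply: smooth_mxD; first exact: openT.
    exact: smooth_mx_cst.
  exact/smooth_stiefel_param_core/szof/openT/openT.
exists U, V, f, g; split.
(* At the centre, 1 + X0^T X0 = 2, which is invertible. *)
- by rewrite /U /= X00 -mulr2n -scaler_nat unitmxZ ?unitmx1 // unitfE pnatr_eq0.
- split=> //; split; apply: smooth_mx_on => //.
    apply: smooth_mx_mul => //; last exact: smooth_mx_cst.
    apply: smooth_mxvec; apply: smooth_stiefel_chart => //.
    exact: smooth_mx_id.
  by apply: smooth_stiefel_param => //; exact: szof.
- apply/seteqP; split=> [_ [X [UX BX] <-]|y [Vy sy]].
    have [VfX _] := fU X UX; split=> // j; apply: (kerB _).1.
    by rewrite mul_vec_lin /= (Bset_chart X0 X00 v X X0v UX).1 // linear0.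
  have [Ugy fgy] := gV y Vy; exists (g y) => //; split=> //.
  apply/(Bset_chart X0 X00 v _ X0v Ugy); apply: (can_inj mxvecK).
  (* The coordinates that must vanish are those of f (g y) = y, which lies in the slice. *)
  rewrite -mul_vec_lin linear0; apply/kerB => j.
  by rewrite -[_ *m B]/(f (g y)) fgy; exact: sy.
Qed.
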